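(* Fix $\delta>0$. For all $x$ sufficiently large in terms of $\delta$, $$\#\{\text{odd } n\le x: l(n)\le x^\beta\}\le x/\mathcal{L}(x)^{\frac12-\beta-\delta}$$ uniformly in $\beta\ge 0$ (that is, there is $x_0(\delta)$, independent of $\beta$, such that the inequality holds for all $x\ge x_0(\delta)$ and all real $\beta\ge 0$).
   Context: For an odd positive integer $n$, $l(n)$ denotes the multiplicative order of $2$ modulo $n$. $\log_k$ denotes the $k$-th iterate of the natural logarithm, and $\mathcal{L}(x)=\exp\left(\frac{\log x\,\log_3 x}{\log_2 x}\right)$. *)

(* Defs.v *)
From HB Require Import structures.
From mathcomp Require Import all_boot all_order all_algebra all_solvable.
From mathcomp Require Import all_classical all_reals all_analysis.

Set Implicit Arguments.
Unset Strict Implicit.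
Unset Printing Implicit Defensive.

Import Order.TTheory GRing.Theory Num.Theory.
Import numFieldNormedType.Exports.

Local Open Scope ring_scope.

(* The order of a unit of 'Z_n is not used because 'Z_1 denotes Z/2.
   If a and n are not coprime the value is the junk value 1. *)
Definition mult_order_spec (a n : nat) : pred nat :=
  fun k => (0 < k)%N && (coprime a n ==> (a ^ k == 1 %[mod n]))%N.

Lemma mult_order_exists (a n : nat) : exists k, mult_order_spec a n k.
Proof.
case: n => [|n].
  exists 1%N; rewrite /mult_order_spec /coprime gcdn0 expn1 /=.
  by apply/implyP => /eqP ->.
exists (totient n.+1); rewrite /mult_order_spec totient_gt0 /=.
by apply/implyP => can; apply/eqP/Euler_exp_totient.
Qed.

Definition mult_order (a n : nat) : nat := ex_minn (mult_order_exists a n).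

Lemma mult_orderP (a n : nat) : coprime a n ->
  [/\ (0 < mult_order a n)%N,
      (a ^ mult_order a n = 1 %[mod n])%N
    & forall k, (0 < k)%N -> (a ^ k = 1 %[mod n])%N -> (mult_order a n <= k)%N].
Proof.
move=> can; rewrite /mult_order; case: ex_minnP => m.
move=> /andP[m0 /implyP /(_ can) /eqP am] mmin.
by split=> // k k0 /eqP ak; apply: mmin; rewrite /mult_order_spec k0 ak implybT.
Qed.

Definition l (n : nat) : nat := mult_order 2%N n.

Definition logk (R : realType) (k : nat) (x : R) : R := iter k (@ln R) x.

Definition calL (R : realType) (x : R) : R :=
  expR (ln x * logk 3 x / logk 2 x).

(* #{odd n <= x : l(n) <= y}; for x >= 0, n <= x iff n <= Num.truncn x. *)
Definition count_small_order (R : realType) (x y : R) : nat :=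
  #|[set n : 'I_(Num.truncn x).+1 | odd n & (l n)%:R <= y]|.

(* Main.v *)
Require Import Defs.
From HB Require Import structures.
From mathcomp Require Import all_boot all_order all_algebra all_solvable.
From mathcomp Require Import all_classical all_reals all_analysis.
From mathcomp Require Import ring lra zify.

Set Implicit Arguments.
Unset Strict Implicit.
Unset Printing Implicit Defensive.

Import Order.TTheory GRing.Theory Num.Theory.
Import numFieldNormedType.Exports.

Local Open Scope ring_scope.

(** Write [lam = ln_3 x / ln_2 x] and [n = a b^2] with [a] squarefree.  Rankin's
trick bounds the number of [n <= x] with [l n <= x^beta] by
  [x^(1 - eps) x^(alpha beta) sum_b b^(-2 + 2 eps) sum_a a^(-1 + eps) L(a)^(-alpha)],
where [L(a)] is the least common multiple of the [l p] for [p | a].  Adjoining a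
prime [p] to [a], with [t = L(a)], multiplies the term by
[p^(-1 + eps) (l p / gcd(l p, t))^(-alpha)].  At most [m] primes have [l p = m] and
they are all 1 mod [m], so with [alpha = 2 eps + 2 kappa] the sum of these factors
over [p] is [O(kappa^-2 sum_(g | t) g^(-1 + s))], where [s = 2 eps + kappa].
Chebyshev's bound makes this [(ln x)^(o(1))] as long as
[s = (1 - d) lam] for a fixed [d > 0].  As the primes of [a] can be adjoined in any
order, the sum over [a] is at most [exp((ln x)^(o(1)))], and the choice
[alpha = lam], [kappa = d lam] gives the exponent [1/2 - beta - delta]. *)

(** * Sums of powers, and sums over subsets *)

Section RealSums.
Variable R : realType.
Implicit Types (x s eta : R).

Lemma powRD_gt0 x r s : 0 < x -> x `^ (r + s) = x `^ r * x `^ s.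
Proof. by move=> x0; apply: powRD; rewrite (gt_eqF x0) implybT. Qed.

(** Integral comparison for [y^(-1 - eta)] on [[m, m + 1]] with [m = n + 1], derived from
    [1 + y <= exp y] and [ln (1 + y) <= y]. *)
Lemma powRN_telescope (eta : R) (n : nat) : 0 < eta ->
  n.+2%:R `^ (-1 - eta) <= eta^-1 * (n.+1%:R `^ (- eta) - n.+2%:R `^ (- eta)).
Proof.
move=> eta0; set m : R := n.+1%:R.
have m0 : 0 < m by rewrite ltr0n.
have -> : n.+2%:R = m + 1 :> R by rewrite -natr1.
have m10 : 0 < m + 1 by lra.
have -> : m `^ (- eta) = (m / (m + 1)) `^ (- eta) * (m + 1) `^ (- eta).
  by rewrite -powRM ?ltW ?divr_gt0// divfK// gt_eqF.
rewrite powRD_gt0// powR_inv1 ?(ltW m10)// -{3}[(m + 1) `^ (- eta)]mul1r -mulrBl mulrA.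
rewrite ler_wpM2r ?powR_ge0// ler_pdivlMl//.
have lnle : ln (m / (m + 1)) <= - (m + 1)^-1.
  have -> : m / (m + 1) = 1 + - (m + 1)^-1.
    by field; rewrite gt_eqF.
  apply: le_ln1Dx; rewrite ltrN2 invf_lt1//; lra.
have : 1 + - eta * ln (m / (m + 1)) <= (m / (m + 1)) `^ (- eta).
  by rewrite /powR gt_eqF ?divr_gt0// expR_ge1Dx.
have : eta * (m + 1)^-1 <= eta * (- ln (m / (m + 1))).
  by rewrite ler_pM2l// lerNr.
lra.
Qed.

Lemma sum_powRN_le (eta : R) (n : nat) : 0 < eta ->
  \sum_(j < n) j.+1%:R `^ (-1 - eta) <= 1 + eta^-1.
Proof.
move=> eta0.
have ei0 : 0 < eta^-1 by rewrite invr_gt0.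
case: n => [|n]; first by rewrite big_ord0; lra.
(* Subtracting the tail strengthens the claim so that the induction telescopes. *)
suff : \sum_(j < n.+1) j.+1%:R `^ (-1 - eta)
    <= 1 + eta^-1 - eta^-1 * n.+1%:R `^ (- eta).
  have : 0 <= eta^-1 * n.+1%:R `^ (- eta) by rewrite mulr_ge0 ?powR_ge0// ltW.
  lra.
elim: n => [|n IH]; first by rewrite big_ord_recl big_ord0 !powR1; lra.
rewrite big_ord_recr /=.
have := powRN_telescope n eta0; lra.
Qed.

Lemma sumr_const_cond (T : finType) (P : pred T) (c : R) :
  \sum_(i | P i) c = #|[pred i | P i]|%:R * c.
Proof. by rewrite mulr_natl -sumr_const; apply: eq_bigl. Qed.

Lemma ler_sum_subpred (T : finType) (P Q : pred T) (F : T -> R) :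
  (forall i, P i -> Q i) -> (forall i, Q i -> 0 <= F i) ->
  \sum_(i | P i) F i <= \sum_(i | Q i) F i.
Proof.
move=> PQ F0; rewrite [leRHS](bigID P) /=.
rewrite [X in _ <= X + _](eq_bigl P); last first.
  by move=> i; case: (boolP (P i)) => [/PQ ->|]; rewrite ?andbF.
by rewrite lerDl sumr_ge0// => i /andP[/F0].
Qed.

Lemma ler_sum_inj (S T : finType) (P : pred S) (Q : pred T) (h : S -> T)
    (F : T -> R) :
  {in P &, injective h} -> (forall i, P i -> Q (h i)) ->
  (forall j, Q j -> 0 <= F j) ->
  \sum_(i | P i) F (h i) <= \sum_(j | Q j) F j.
Proof.
move=> hinj PQ F0; rewrite -(big_imset F hinj).
by apply: ler_sum_subpred => // j /imsetP[i Pi ->]; exact: PQ.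
Qed.

(** Distinct positive integers contribute at most the full series. This serves for the cofactors
    [p %/ d], the quotients [d %/ g] and the square parts [b]. *)
Lemma sum_inj_powRN_le (T : finType) (P : pred T) (h : T -> nat) eta :
  0 < eta -> {in P &, injective h} -> (forall i, P i -> (0 < h i)%N) ->
  \sum_(i | P i) (h i)%:R `^ (-1 - eta) <= 1 + eta^-1.
Proof.
move=> eta0 hinj h0; pose B := \max_(i | P i) h i.
have hB i : P i -> ((h i).-1 < B.+1)%N.
  move=> Pi; have := @leq_bigmax_cond _ P h i Pi; rewrite -/B.
  by move: (h0 i Pi); lia.
have hK i : P i -> (inord (h i).-1 : 'I_B.+1).+1 = h i.
  by move=> Pi; rewrite inordK ?hB// prednK ?h0.
rewrite (eq_bigr (fun i => (inord (h i).-1 : 'I_B.+1).+1%:R `^ (-1 - eta))).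
  apply: le_trans (sum_powRN_le B.+1 eta0).
  apply: (@ler_sum_inj _ _ P predT (fun i => inord (h i).-1 : 'I_B.+1)
           (fun j => j.+1%:R `^ (-1 - eta))) => //.
  move=> i j Pi Pj /(congr1 (fun k : 'I_B.+1 => k.+1)).
  by rewrite !hK//; exact: hinj.
by move=> i Pi; rewrite hK.
Qed.

Lemma sum_exp_coeff_le (M : R) n : 0 <= M ->
  \sum_(k < n) M ^+ k / k`!%:R <= expR M.
Proof.
move=> M0.
have nd : nondecreasing_seq (series (exp_coeff M)).
  apply/nondecreasing_seqP => k; rewrite /series /= big_nat_recr//=.
  by rewrite lerDl exp_coeff_ge0.
have := nondecreasing_cvgn_le nd (is_cvg_series_exp_coeff M) n.
by rewrite /expR /series /= big_mkord.
Qed.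

(* Each set of size k.+1 arises k.+1 times by adding a point to a set of size k,
   so the sets of size k contribute at most [F finset.set0 * M ^+ k / k`!]. *)
Lemma sum_set_le_expR (T : finType) (F : {set T} -> R) (M : R) :
  0 <= M -> (forall A : {set T}, 0 <= F A) ->
  (forall A : {set T}, \sum_(p | p \notin A) F (p |: A) <= M * F A) ->
  \sum_A F A <= F finset.set0 * expR M.
Proof.
move=> M0 F0 FM; pose S k := \sum_(A : {set T} | #|A| == k) F A.
have step k : k.+1%:R * S k.+1 <= M * S k.
  rewrite /S mulr_sumr [leRHS]mulr_sumr.
  rewrite (eq_bigr (fun A : {set T} => \sum_(p in A) F A)); last first.
    by move=> A /eqP <-; rewrite sumr_const mulr_natl.
  rewrite (exchange_big_dep predT)//=.
  rewrite (eq_bigr (fun p => \sum_(B : {set T} | (#|B| == k) && (p \notin B))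
                               F (p |: B))); last first.
    move=> p _; rewrite (reindex_onto (fun B => p |: B) (fun A => A :\ p)) /=.
      apply: eq_bigl => B; rewrite finset.setU11 andbT cardsU1.
      case: (boolP (p \in B)) => pB /=; last by rewrite add1n eqSS setU1K ?eqxx.
      rewrite andbF; apply/negbTE; rewrite negb_and; apply/orP; right.
      by apply: contraTneq pB => <-; rewrite !inE eqxx.
    by move=> A /andP[_ pA]; rewrite finset.setD1K.
  rewrite (exchange_big_dep (fun B : {set T} => #|B| == k))/=; last first.
    by move=> ? ? _ /andP[].
  apply: ler_sum => B /eqP Bk; apply: le_trans (FM B).
  by rewrite (eq_bigl (fun p => p \notin B))// => p; rewrite Bk eqxx.
have Sk k : S k <= F finset.set0 * (M ^+ k / k`!%:R).
  elim: k => [|k IH].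
    rewrite /S (big_pred1 finset.set0) ?expr0 ?divr1 ?mulr1// => A.
    by rewrite cards_eq0.
  have k0 : (0 : R) < k.+1%:R by rewrite ltr0n.
  rewrite -(ler_pM2l k0); apply: le_trans (step k) _.
  apply: le_trans (ler_wpM2l M0 IH) _.
  rewrite factS natrM exprS le_eqVlt; apply/orP; left; apply/eqP; field.
  by rewrite !gt_eqF ?ltr0n ?fact_gt0.
rewrite (partition_big (fun A : {set T} => inord #|A| : 'I_#|T|.+1) predT)//=.
apply: (@le_trans _ _ (\sum_(k < #|T|.+1) F finset.set0 * (M ^+ k / k`!%:R))).
  apply: ler_sum => k _; apply: le_trans (Sk k); rewrite /S.
  rewrite (eq_bigl (fun A : {set T} => #|A| == k))// => A.
  apply/eqP/eqP => [<-|]; first by rewrite inordK// ltnS max_card.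
  by move=> Ak; apply: val_inj; rewrite /= inordK// Ak.
by rewrite -mulr_sumr ler_wpM2l// sum_exp_coeff_le.
Qed.

End RealSums.

(** * The order of 2 and Rankin sums over primes *)

Lemma l_gt0 n : odd n -> (0 < l n)%N.
Proof. by rewrite -coprime2n => /mult_orderP[]. Qed.

Lemma exp2_l n : odd n -> (2 ^ l n = 1 %[mod n])%N.
Proof. by rewrite -coprime2n => /mult_orderP[]. Qed.

Lemma l_dvd n m : odd n -> (2 ^ m = 1 %[mod n])%N -> (l n %| m)%N.
Proof.
move=> on; have l0 := l_gt0 on; rewrite {1}(divn_eq m (l n)) expnD.
rewrite (mulnC (m %/ l n)%N) expnM.
rewrite -modnMml -modnXm exp2_l// modnXm exp1n modnMml mul1n => h.
case: (posnP (m %% l n)) => [/eqP//|r0].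
have := on; rewrite -coprime2n => /mult_orderP[_ _ /(_ _ r0 h)].
by rewrite -/(l n) leqNgt ltn_mod l0.
Qed.

Lemma l_dvd_l p n : odd n -> (p %| n)%N -> (l p %| l n)%N.
Proof.
move=> on pn; apply: l_dvd; first exact: dvdn_odd pn on.
by rewrite -(modn_dvdm (2 ^ l n) pn) exp2_l// modn_dvdm.
Qed.

Lemma l_prime_dvd p : prime p -> odd p -> (l p %| p.-1)%N.
Proof.
move=> pp op; apply: l_dvd => //.
by rewrite -totient_prime//; apply: Euler_exp_totient; rewrite coprime2n.
Qed.

Lemma l_prime_le p : prime p -> odd p -> (l p < p)%N.
Proof.
move=> pp op; have p1 := prime_gt1 pp.
have := dvdn_leq _ (l_prime_dvd pp op).
by lia.
Qed.

(** Each distinct prime factor of [m] that is at least [y] contributes a factor at least [y] to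
    [m]. *)
Lemma expn_count_primes_le y m : (0 < m)%N ->
  (y ^ count (leq y) (primes m) <= m)%N.
Proof.
move=> m0; rewrite {2}(prod_prime_decomp m0) /primes count_map.
have : all (fun f => f.1 <= f.1 ^ f.2)%N (prime_decomp m).
  apply/allP => -[p e] /mem_prime_decomp[pp e0 _] /=.
  by rewrite -{1}(expn1 p) leq_exp2l// prime_gt1.
have : all (fun f => 0 < f.1)%N (prime_decomp m).
  by apply/allP => -[p e] /mem_prime_decomp[/prime_gt0].
elim: (prime_decomp m) => [|f s IH] /=; first by rewrite big_nil.
case/andP=> f0 s0 /andP[fe se]; rewrite big_cons expnD leq_mul ?IH//.
case: (leqP y f.1) => yf; last by rewrite expn0 expn_gt0 f0.
by rewrite expn1 (leq_trans yf).
Qed.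

Lemma expn_card_prime_dvd_le N y m : (0 < m)%N -> (0 < y)%N ->
  (y ^ #|[pred q : 'I_N | [&& prime q, q %| m & y <= q]]| <= m)%N.
Proof.
move=> m0 y0; apply: leq_trans (expn_count_primes_le y m0).
rewrite leq_pexp2l// -size_filter cardE -(size_map val).
apply: uniq_leq_size; first by rewrite map_inj_uniq ?enum_uniq//; exact: val_inj.
move=> p /mapP[q]; rewrite mem_enum inE => /and3P[pq qm yq] ->.
by rewrite mem_filter yq mem_primes pq m0.
Qed.

(** Primes with [l p = d] all divide [2 ^ d - 1], and a product of [c] distinct primes is at least
    [2 ^ c]. *)
Lemma card_l_eq N d : (0 < d)%N ->
  (#|[pred p : 'I_N | prime p && odd p && (l p == d)]| <= d)%N.
Proof.
move=> d0; have m0 : (0 < 2 ^ d - 1)%N.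
  by rewrite subn_gt0 -{1}(expn0 2) ltn_exp2l.
rewrite -(@leq_exp2l 2)//; apply: leq_trans (leq_subr 1 (2 ^ d)).
apply: leq_trans (expn_card_prime_dvd_le N m0 (ltn0Sn 1)).
rewrite leq_exp2l//; apply: subset_leq_card; apply/fintype.subsetP => q.
rewrite !inE => /andP[/andP[pq oq] /eqP lq].
rewrite pq prime_gt1// andbT.
by have /eqP := exp2_l oq; rewrite lq eqn_mod_dvd ?expn_gt0.
Qed.

Section OrderSums.
Variable R : realType.
Implicit Types eps kappa : R.

Lemma ler_powR_nonpos (a b r : R) : 0 < a -> a <= b -> r <= 0 ->
  b `^ r <= a `^ r.
Proof.
move=> a0 ab r0; have b0 := lt_le_trans a0 ab.
rewrite -[r]opprK !(powRN _ (- r)) lef_pV2 ?posrE ?powR_gt0//.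
by apply: ge0_ler_powR; rewrite ?oppr_ge0 ?nnegrE// ltW.
Qed.

(** Such primes have the form [d * j + 1] with [j > 0]. Small [j] are summed as a convergent series,
    giving [1 + kappa^-1]; for large [j] the bound [d] on the number of primes gives the remaining
    1. *)
Lemma sum_l_eq_le N d eps kappa : (0 < d)%N ->
  0 <= eps <= 1 -> 0 < kappa ->
  \sum_(p < N | prime p && odd p && (l p == d)) p%:R `^ (-1 + eps)
    <= (2 + kappa^-1) * d%:R `^ (-1 + 2 * eps + kappa).
Proof.
move=> d0 /andP[e0 e1] k0.
have dR0 : 0 < d%:R :> R by rewrite ltr0n.
have dR1 : 1 <= d%:R :> R by rewrite ler1n.
have pj p : prime p && odd p && (l p == d) ->
    exists2 j, (0 < j)%N & p = (d * j).+1.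
  case/andP=> /andP[pp op] /eqP <-; have /dvdnP[j pj] := l_prime_dvd pp op.
  have p1 := prime_gt1 pp; exists j; last by rewrite mulnC -pj; lia.
  by case: j pj => //; lia.
have pd p : prime p && odd p && (l p == d) -> (0 < p %/ d)%N.
  by case/pj=> j j0 ->; rewrite divn_gt0// ltnW// ltnS leq_pmulr.
have term (p : 'I_N) : prime p && odd p && (l p == d) ->
    p%:R `^ (-1 + eps) <= d%:R `^ (-1 + 2 * eps + kappa) *
      ((p %/ d)%:R `^ (-1 - kappa) + d%:R^-1).
  move=> Pp; have j0 := pd _ Pp.
  have jR0 : 0 < (p %/ d)%:R :> R by rewrite ltr0n.
  have dj : (p %/ d)%:R * d%:R <= p%:R :> R by rewrite -natrM ler_nat leq_divM.
  apply: le_trans (ler_powR_nonpos _ dj _) _; [exact: mulr_gt0|lra|].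
  rewrite powRM ?(ltW jR0)// ?(ltW dR0)// mulrC.
  have -> : -1 + 2 * eps + kappa = (-1 + eps) + (eps + kappa) by ring.
  rewrite (powRD_gt0 (-1 + eps) (eps + kappa) dR0) -mulrA ler_wpM2l ?powR_ge0//.
  (* For [j <= d] trade [j^(eps + kappa)] for [d^(eps + kappa)]; for [j > d] use
     [j^(-1 + eps) <= d^(-1 + eps)]. *)
  case: (leqP (p %/ d) d) => [jd|dj'].
    have -> : -1 + eps = (eps + kappa) + (-1 - kappa) by ring.
    rewrite (powRD_gt0 (eps + kappa) (-1 - kappa) jR0).
    apply: ler_pM; rewrite ?powR_ge0//.
      by apply: ge0_ler_powR; rewrite ?nnegrE ?ler_nat//; lra.
    by rewrite lerDl invr_ge0 ltW.
  apply: (@le_trans _ _ (d%:R `^ (-1 + eps))).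
    by apply: ler_powR_nonpos => //; [rewrite ler_nat ltnW|lra].
  rewrite [-1 + eps]addrC (powRD_gt0 eps (-1) dR0) powR_inv1 ?(ltW dR0)//.
  apply: ler_pM; rewrite ?powR_ge0 ?invr_ge0 ?(ltW dR0)//.
    by apply: ler_powR => //; lra.
  by rewrite lerDr powR_ge0.
apply: le_trans (ler_sum _ term) _.
rewrite -mulr_sumr mulrC ler_wpM2r ?powR_ge0// big_split /=.
rewrite addrC (_ : 2 + kappa^-1 = 1 + (1 + kappa^-1)); last by ring.
apply: lerD; last first.
  apply: (@sum_inj_powRN_le _ _ _ (fun p : 'I_N => p %/ d)%N) => //.
  move=> p q /pj[i i0 pE] /pj[j j0 qE] /= pq; apply: val_inj => /=.
  move: pq; rewrite pE qE.
  (* The quotient [p %/ d] equals [j] only for [d >= 2]; for [d = 1] it is [p] itself. *)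
  case: d d0 {dR0 dR1 pj pd term pE qE} => // -[|d] _; first by rewrite !divn1.
  have divE k : ((d.+2 * k).+1 %/ d.+2 = k)%N.
    by rewrite -addn1 mulnC divnMDl// divn_small// addn0.
  by rewrite !divE => ->.
  by move=> p; exact: pd.
rewrite sumr_const_cond ler_pdivrMr// mul1r ler_nat.
exact: card_l_eq.
Qed.

(** Sort by [g = gcd(d, t)] and write [d = g * j]: the exponents combine to [j^(-1 - kappa) * g^(-1
    + 2 * eps + kappa)], and the sum over [j] converges. *)
Lemma sum_gcd_le N t eps kappa : (0 < t)%N -> 0 < kappa ->
  \sum_(d < N | (0 < d)%N) (d %/ gcdn d t)%:R `^ (- (2 * eps + 2 * kappa))
      * d%:R `^ (-1 + 2 * eps + kappa)
    <= (1 + kappa^-1) *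
       \sum_(g < t.+1 | (g %| t)%N) g%:R `^ (-1 + (2 * eps + kappa)).
Proof.
move=> t0 k0.
have gt d : (gcdn d t < t.+1)%N by rewrite ltnS dvdn_leq// dvdn_gcdr.
rewrite (partition_big (fun d : 'I_N => inord (gcdn d t) : 'I_t.+1)
          (fun g : 'I_t.+1 => (g %| t)%N)) /=; last first.
  by move=> d _; rewrite inordK// dvdn_gcdr.
rewrite mulr_sumr; apply: ler_sum => g gdvd.
rewrite (eq_bigr (fun d : 'I_N => (d %/ g)%:R `^ (-1 - kappa)
           * g%:R `^ (-1 + (2 * eps + kappa)))); last first.
  move=> d /andP[d0 /eqP <-]; rewrite inordK//.
  have dg : (0 < d %/ gcdn d t)%N.
    by rewrite divn_gt0 ?gcdn_gt0 ?d0// dvdn_leq// dvdn_gcdl.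
  rewrite -{3}(divnK (dvdn_gcdl d t)) natrM powRM// mulrA.
  rewrite -powRD_gt0 ?ltr0n//; congr (_ `^ _ * _ `^ _); ring.
rewrite -mulr_suml ler_wpM2r ?powR_ge0//.
apply: (@sum_inj_powRN_le _ _ _ (fun d : 'I_N => d %/ g)%N) => //.
  move=> d e /andP[_ /eqP/(congr1 val)] /=; rewrite inordK// => gd.
  move=> /andP[_ /eqP/(congr1 val)] /=; rewrite inordK// => ge de.
  apply: val_inj => /=.
  by rewrite -(divnK (dvdn_gcdl d t)) -(divnK (dvdn_gcdl e t)) gd ge de.
move=> d /andP[d0 /eqP <-]; rewrite inordK//.
by rewrite divn_gt0 ?gcdn_gt0 ?d0// dvdn_leq// dvdn_gcdl.
Qed.

(** Sort the primes by [d = l p]: [sum_l_eq_le] handles each class and [sum_gcd_le] the sum over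
    [d]. *)
Lemma sum_prime_le N t eps kappa : (0 < t)%N -> 0 <= eps <= 1 -> 0 < kappa ->
  \sum_(p < N | prime p && odd p)
      (l p %/ gcdn (l p) t)%:R `^ (- (2 * eps + 2 * kappa)) * p%:R `^ (-1 + eps)
    <= (2 + kappa^-1) * (1 + kappa^-1) *
       \sum_(g < t.+1 | (g %| t)%N) g%:R `^ (-1 + (2 * eps + kappa)).
Proof.
move=> t0 e01 k0.
have lN (p : 'I_N) : prime p && odd p -> (l p < N)%N.
  by case/andP=> pp op; exact: ltn_trans (l_prime_le pp op) (ltn_ord p).
case: N lN => [|N] lN.
  rewrite big_ord0 !mulr_ge0 ?sumr_ge0// ?addr_ge0// ?invr_ge0 ?ltW//.
rewrite (partition_big (fun p : 'I_N.+1 => inord (l p) : 'I_N.+1)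
          (fun d : 'I_N.+1 => (0 < d)%N)) /=; last first.
  by move=> p Pp; rewrite inordK ?lN//; case/andP: Pp => _ /l_gt0.
rewrite -mulrA.
apply: le_trans (ler_wpM2l _ (sum_gcd_le N.+1 eps t0 k0)); last first.
  by rewrite addr_ge0// invr_ge0 ltW.
rewrite mulr_sumr; apply: ler_sum => d d0.
rewrite mulrCA.
apply: le_trans (ler_wpM2l (powR_ge0 _ _) (sum_l_eq_le N.+1 d0 e01 k0)).
rewrite mulr_sumr le_eqVlt; apply/orP; left; apply/eqP.
have dE (p : 'I_N.+1) : prime p && odd p && (inord (l p) == d) =
    prime p && odd p && (l p == d).
  case: (boolP (prime p && odd p)) => //= Pp.
  apply/eqP/eqP => [<-|ld]; first by rewrite inordK ?lN.
  by apply: val_inj; rewrite /= inordK ?lN.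
rewrite (eq_bigl _ _ dE); apply: eq_bigr => p /andP[_ /eqP ->] //.
Qed.

End OrderSums.

(** * Divisor sums *)

Section DivisorSums.
Variable R : realType.
Implicit Types s kappa : R.

(** For positive [t] this is the divisor function sigma with exponent [s - 1]. *)
Definition divisor_sum (t : nat) (s : R) : R :=
  \sum_(g < t.+1 | (g %| t)%N) g%:R `^ (-1 + s).

Lemma two_powR_le s : s <= 1 / 2 -> 2 `^ (-1 + s) <= 3 / 4 :> R.
Proof.
move=> s2; apply: (@le_trans _ _ (2 `^ (- (1 / 2)))).
  by apply: ler_powR; lra.
have : (2 `^ (- (1 / 2)) : R) ^+ 2 = 2^-1.
  by rewrite -powR_mulrn ?powR_ge0// -powRrM -[RHS]powR_inv1//; congr (_ `^ _); field.
have := powR_ge0 (2 : R) (- (1 / 2)); nra.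
Qed.

Lemma prime_powR_le q s : prime q -> s <= 1 / 2 -> q%:R `^ (-1 + s) <= 3 / 4 :> R.
Proof.
move=> pq s2; apply: le_trans (two_powR_le s2).
by apply: ler_powR_nonpos; rewrite ?ler_nat ?prime_gt1//; lra.
Qed.

(** For [u <= 3 / 4], [1 / (1 - u) <= 1 + 4 * u]; this bounds one Euler factor. *)
Lemma sum_geometric_le_expR (u : R) n : 0 <= u <= 3 / 4 ->
  \sum_(i < n) u ^+ i <= expR (4 * u).
Proof.
move=> /andP[u0 u1]; apply: le_trans (expR_ge1Dx _).
elim: n => [|n IH]; first by rewrite big_ord0; lra.
rewrite big_ord_recl expr0 (eq_bigr (fun i : 'I_n => u * u ^+ i)); last first.
  by move=> i _; rewrite -exprS.
rewrite -mulr_sumr; nra.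
Qed.

(** Sending [g] to its [q]-adic valuation and its [q]-free part is injective on the divisors. *)
Lemma divisor_sum_pfactor q a m s : prime q -> (0 < m)%N -> coprime q m ->
  divisor_sum (q ^ a * m) s
    <= (\sum_(i < a.+1) (q%:R `^ (-1 + s)) ^+ i) * divisor_sum m s.
Proof.
move=> pq m0 cqm; rewrite /divisor_sum.
have q0 := prime_gt0 pq.
have t0 : (0 < q ^ a * m)%N by rewrite muln_gt0 expn_gt0 q0.
have bnd g : (g %| q ^ a * m)%N -> (logn q g < a.+1)%N.
  move=> /(dvdn_leq_log q t0); rewrite lognM ?expn_gt0 ?q0// pfactorK//.
  by rewrite (logn_coprime cqm) addn0 ltnS.
have dvd g : (g %| q ^ a * m)%N -> (g`_q^' %| m)%N.
  move=> gt; have := partn_dvd q^' t0 gt; rewrite partnM ?expn_gt0 ?q0//.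
  rewrite (_ : (q ^ a)`_q^' = 1)%N ?mul1n; last first.
    by rewrite part_p'nat// pnatNK pnatX pnat_id.
  by rewrite (@part_pnat_id q^' m)// p'natE// -prime_coprime.
have le g : (g %| q ^ a * m)%N -> (g`_q^' < m.+1)%N.
  by move=> /dvd /(dvdn_leq m0).
have dec g : (g %| q ^ a * m)%N -> g = (q ^ logn q g * g`_q^')%N.
  by move=> /(dvdn_gt0 t0) g0; rewrite -p_part partnC.
rewrite mulr_suml; under [leRHS]eq_bigr do rewrite mulr_sumr.
rewrite pair_big_dep /=.
pose h (g : 'I_(q ^ a * m).+1) : 'I_a.+1 * 'I_m.+1 :=
  (inord (logn q g), inord g`_q^').
pose G (p : 'I_a.+1 * 'I_m.+1) : R :=
  (q%:R `^ (-1 + s)) ^+ p.1 * p.2%:R `^ (-1 + s).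
rewrite (eq_bigr (fun g => G (h g))) => [|g gt]; last first.
  rewrite /G /h /= !inordK ?bnd ?le// {1}(dec g gt) natrM powRM//.
  by rewrite natrX -!powR_mulrn ?powR_ge0// powRAC.
apply: (@ler_sum_inj R _ _ _ _ h G).
- move=> g g' gt gt' /(congr1 (fun p => (val p.1, val p.2))).
  rewrite /h /= !inordK ?bnd ?le// => -[e1 e2].
  by apply: val_inj; rewrite /= (dec g gt) (dec g' gt') e1 e2.
- by move=> g gt; rewrite /h /= inordK ?le// dvd.
- by move=> p _; rewrite /G mulr_ge0 ?exprn_ge0 ?powR_ge0.
Qed.

(** Euler product bound: strong induction splits off the full power of the least prime factor of
    [t]. *)
Lemma divisor_sum_le_expR N t s : (0 < t < N)%N -> s <= 1 / 2 ->
  divisor_sum t s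
    <= expR (4 * \sum_(q < N | prime q && (q %| t)%N) q%:R `^ (-1 + s)).
Proof.
move=> + s2; elim/ltn_ind: t => t IH /andP[t0 tN].
case: (leqP t 1) => [t1|t1].
  have -> : t = 1%N by lia.
  rewrite /divisor_sum big_mkcond !big_ord_recl big_ord0 /= powR1 add0r addr0.
  by rewrite -expR0 ler_expR mulr_ge0// sumr_ge0// => *; exact: powR_ge0.
have pq := pdiv_prime t1; set q := pdiv t in pq.
have qt : (q %| t)%N := pdiv_dvd t.
have [m cqm tE] := pfactor_coprime pq t0.
have a0 : (0 < logn q t)%N by rewrite logn_gt0 mem_primes pq t0.
set a := logn q t in tE a0.
have m0 : (0 < m)%N by move: t0; rewrite tE muln_gt0 => /andP[].
have qa : (1 < q ^ a)%N by rewrite -(exp1n a) ltn_exp2r// prime_gt1.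
have mt : (m < t)%N by rewrite tE ltn_Pmulr.
have qN : (q < N)%N := leq_ltn_trans (dvdn_leq t0 qt) tN.
rewrite {1}tE mulnC; apply: le_trans (divisor_sum_pfactor a s pq m0 cqm) _.
rewrite (bigD1 (Ordinal qN)) /= ?pq ?qt// mulrDr expRD.
apply: ler_pM.
- by rewrite sumr_ge0// => i _; rewrite exprn_ge0 ?powR_ge0.
- by rewrite sumr_ge0// => i _; rewrite powR_ge0.
- by apply: sum_geometric_le_expR; rewrite powR_ge0 prime_powR_le.
have mN : (0 < m < N)%N by rewrite m0 (ltn_trans mt tN).
apply: le_trans (IH m mt mN) _.
rewrite ler_expR ler_wpM2l//; apply: ler_sum_subpred => [r|r _]; last first.
  exact: powR_ge0.
case/andP=> pr rm; rewrite pr {1}tE dvdn_mulr//=.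
apply: contraTneq cqm => rE; move: rm; rewrite rE /=.
by rewrite prime_coprime// negbK.
Qed.

(** * Chebyshev's bound and sums over the prime divisors of an integer *)

Lemma prime_dvd_fact p n : prime p -> (p %| n`!)%N = (p <= n)%N.
Proof.
move=> pp; apply/idP/idP => [|pn]; last by rewrite dvdn_fact// prime_gt0.
elim: n => [|n IH]; first by rewrite fact0 dvdn1 => /eqP pE; rewrite pE in pp.
rewrite factS Euclid_dvdM// => /orP[/dvdn_leq->//|/IH pn].
exact: leqW.
Qed.

Lemma card_prime_dyadic N k :
  (k.+1 * #|[pred q : 'I_N | [&& prime q, 2 ^ k.+1 <= q & q < 2 ^ k.+2]]|
     <= 2 ^ k.+2)%N.
Proof.
(* The first block [[2, 4)] is separate because its left endpoint is prime; later endpoints are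
   proper powers of 2. *)
case: k => [|k].
  rewrite mul1n cardE -(size_map val); apply: (@leq_trans 2) => //.
  apply: (@uniq_leq_size _ _ [:: 2; 3]%N).
    by rewrite map_inj_uniq ?enum_uniq//; exact: val_inj.
  move=> q /mapP[r]; rewrite mem_enum inE => /and3P[_ + +] -> /=.
  by case: (nat_of_ord r) => [|[|[|[|]]]].
set n := (2 ^ k.+2)%N; have n0 : (0 < n)%N by rewrite expn_gt0.
have n2 : (2 ^ k.+3 = n + n)%N by rewrite expnS mul2n addnn.
have bin0 : (0 < 'C(n + n, n))%N by rewrite bin_gt0 leq_addr.
have bin2 : ('C(n + n, n) <= 2 ^ (2 ^ k.+3))%N.
  rewrite n2 -[2%N]/(1 + 1)%N expnDn.
  have nn : (n < (n + n).+1)%N by rewrite ltnS leq_addr.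
  rewrite (bigD1 (Ordinal nn)) //= !exp1n !muln1; exact: leq_addr.
rewrite -(@leq_exp2l 2)// expnM; apply: leq_trans bin2.
apply: leq_trans (expn_card_prime_dvd_le N bin0 n0).
rewrite leq_exp2l; last by rewrite -{1}(expn0 2) ltn_exp2l.
apply: subset_leq_card; apply/fintype.subsetP => q.
rewrite !inE n2 => /and3P[pq nq qn2]; rewrite pq nq andbT /=.
have nq' : (n < q)%N.
  rewrite ltn_neqAle nq andbT; apply/eqP => nq2; move: pq; rewrite -nq2 => pn.
  have := dvdn_exp (ltn0Sn k.+1) (dvdnn 2).
  rewrite dvdn_prime2// => /eqP; rewrite !expnS.
  have : (0 < 2 ^ k)%N by rewrite expn_gt0.
  lia.
(* A prime strictly between [n] and [2n] divides [(2n)!] but not [n!], hence divides the central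
   binomial coefficient. *)
have : (q %| (n + n)`!)%N by rewrite dvdn_fact// prime_gt0// ltnW.
rewrite -(bin_fact (leq_addr n n)) addnK Euclid_dvdM// Euclid_dvdM//.
have qnf : ~~ (q %| n`!)%N by rewrite prime_dvd_fact// -ltnNge.
by rewrite (negbTE qnf) !orbF.
Qed.

(** By [card_prime_dyadic], the primes in [[2^(k+1), 2^(k+2))] contribute at most [2 / (k + 1)]. *)
Lemma sum_prime_inv_le N K :
  \sum_(q < N | prime q && (q < 2 ^ K.+1)%N) q%:R^-1
    <= 2 * \sum_(k < K) k.+1%:R^-1 :> R.
Proof.
elim: K => [|K IH].
  by rewrite big_ord0 mulr0 big_pred0// => -[[|[|[|q]]] //= ?]; rewrite andbF.
rewrite big_ord_recr /= mulrDr.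
rewrite (bigID (fun q : 'I_N => (q < 2 ^ K.+1)%N)) /=; apply: lerD.
  apply: le_trans IH; apply: ler_sum_subpred => q.
    by move=> /andP[/andP[-> _] ->].
  by rewrite invr_ge0.
set y : nat := (2 ^ K.+1)%N.
have yR0 : 0 < y%:R :> R by rewrite ltr0n expn_gt0.
apply: (@le_trans _ _
    (\sum_(q < N | [&& prime q, y <= q & q < 2 ^ K.+2]%N) y%:R^-1)).
  rewrite [leRHS](eq_bigl (fun q : 'I_N =>
      prime q && (q < 2 ^ K.+2) && ~~ (q < y))%N); last first.
    by move=> q; rewrite -leqNgt -andbA; congr (_ && _); rewrite andbC.
  apply: ler_sum => q /andP[_]; rewrite -leqNgt => yq.
  by rewrite lef_pV2 ?posrE ?ler_nat// ltr0n (leq_trans _ yq)// expn_gt0.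
rewrite sumr_const_cond ler_pdivrMr// mulrAC ler_pdivlMr ?ltr0n//.
rewrite mulrC -!natrM ler_nat -expnS.
exact: card_prime_dyadic.
Qed.

(** A small power replaces the logarithm: [1 / k = k^kappa * k^(-1 - kappa)]. *)
Lemma sum_inv_le_powR K kappa : 0 < kappa ->
  \sum_(k < K) k.+1%:R^-1 <= K%:R `^ kappa * (1 + kappa^-1).
Proof.
move=> k0; apply: le_trans (ler_wpM2l (powR_ge0 _ _) (sum_powRN_le K k0)).
rewrite mulr_sumr; apply: ler_sum => k _.
have kk : 0 < k.+1%:R :> R by rewrite ltr0n.
rewrite -powR_inv1 ?(ltW kk)//.
rewrite [X in _ `^ X](_ : -1 = kappa + (-1 - kappa)); last by ring.
rewrite powRD_gt0// ler_wpM2r ?powR_ge0//.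
by apply: ge0_ler_powR; rewrite ?nnegrE ?ler_nat//; lra.
Qed.

(** Split at [y = 2 ^ K.+1]. Since [t < 2 ^ y], at most [y] primes divide [t], so those from [y] on
    give at most [y^s]; a prime [q] below [y] gives at most [y^s / q]. *)
Lemma sum_prime_dvd_le N K t s kappa : (0 < t < 2 ^ (2 ^ K.+1))%N ->
  0 <= s <= 1 -> 0 < kappa ->
  \sum_(q < N | prime q && (q %| t)%N) q%:R `^ (-1 + s)
    <= (2 ^ K.+1)%:R `^ s * (1 + 2 * (K%:R `^ kappa * (1 + kappa^-1))).
Proof.
move=> /andP[t0 tK] /andP[s0 s1] k0; set y : nat := (2 ^ K.+1)%N.
have y0 : (0 < y)%N by rewrite expn_gt0.
have yR0 : 0 < y%:R :> R by rewrite ltr0n.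
rewrite (bigID (fun q : 'I_N => (y <= q)%N)) /= mulrDr; apply: lerD.
  apply: (@le_trans _ _ (\sum_(q < N | prime q && (q %| t)%N && (y <= q)%N)
                           y%:R `^ (-1 + s))).
    apply: ler_sum => q /andP[_ yq].
    by apply: ler_powR_nonpos; rewrite ?ler_nat//; lra.
  rewrite sumr_const_cond addrC (powRD_gt0 s (-1) yR0) mulrCA.
  rewrite ler_wpM2l ?powR_ge0// powR_inv1 ?(ltW yR0)// ler_pdivrMr// mul1r.
  rewrite ler_nat -(@leq_exp2l 2)//.
  apply: leq_trans (ltnW tK).
  apply: leq_trans (expn_card_prime_dvd_le N t0 (ltn0Sn 1)).
  rewrite leq_exp2l//; apply: subset_leq_card; apply/fintype.subsetP => q.
  by rewrite !inE => /andP[/andP[pq ->] _]; rewrite pq prime_gt1.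
apply: (@le_trans _ _
    (y%:R `^ s * \sum_(q < N | prime q && (q < y)%N) q%:R^-1)); last first.
  rewrite ler_wpM2l ?powR_ge0//; apply: le_trans (sum_prime_inv_le N K) _.
  by rewrite ler_wpM2l// sum_inv_le_powR.
rewrite mulr_sumr.
apply: (@le_trans _ _ (\sum_(q < N | prime q && (q %| t)%N && ~~ (y <= q)%N)
                         y%:R `^ s * q%:R^-1)).
  apply: ler_sum => q /andP[/andP[pq _]]; rewrite -ltnNge => qy.
  have q0 : 0 < q%:R :> R by rewrite ltr0n prime_gt0.
  rewrite addrC (powRD_gt0 s (-1) q0) powR_inv1 ?(ltW q0)//.
  rewrite ler_wpM2r ?invr_ge0 ?(ltW q0)//.
  by apply: ge0_ler_powR; rewrite ?nnegrE ?ler_nat// ltnW.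
apply: ler_sum_subpred => q; last by rewrite mulr_ge0 ?powR_ge0 ?invr_ge0.
by move=> /andP[/andP[-> _]]; rewrite -ltnNge.
Qed.

End DivisorSums.

(** * Rankin's bound for the counting function *)

Section Rankin.
Variables (R : realType) (N : nat).
Implicit Types (A : {set 'I_N}) (p n : 'I_N) (eps kappa : R).

Definition lcm_l A : nat := \big[lcmn/1%N]_(p in A) l p.

(** A squarefree odd [a < N] is encoded by the set of its prime factors. *)
Definition admissible A : bool :=
  [forall p in A, prime p && odd p] && (\prod_(p in A) p < N)%N.

(** The value 0 off the admissible sets lets the sum run over all subsets, as [sum_set_le_expR]
    requires. *)
Definition weight eps alpha A : R :=
  if admissible A then
    (\prod_(p in A) p)%N%:R `^ (-1 + eps) * (lcm_l A)%:R `^ (- alpha)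
  else 0.

Lemma weight_ge0 eps alpha A : 0 <= weight eps alpha A.
Proof. by rewrite /weight; case: ifP => // _; rewrite mulr_ge0 ?powR_ge0. Qed.

Lemma admissibleP A p : admissible A -> p \in A -> prime p && odd p.
Proof. by case/andP=> /forall_inP h _ /h. Qed.

Lemma lcm_l_gt0 A : admissible A -> (0 < lcm_l A)%N.
Proof.
move=> adm; rewrite /lcm_l; elim/big_ind: _ => // [m k m0 k0|p pA].
  by rewrite lcmn_gt0 m0.
by apply: l_gt0; case/andP: (admissibleP adm pA).
Qed.

Lemma lcm_l_lt A : admissible A -> (lcm_l A < N)%N.
Proof.
move=> adm; apply: leq_ltn_trans (proj2 (andP adm)).
have /dvdn_leq : (lcm_l A %| \prod_(p in A) l p)%N.
  by apply/dvdn_biglcmP => p pA; rewrite (bigD1 p)//= dvdn_mulr.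
move=> h; apply: leq_trans (h _) _.
  by apply: prodn_cond_gt0 => p /(admissibleP adm)/andP[_ /l_gt0].
apply: leq_prod => p /(admissibleP adm)/andP[pp op].
exact: ltnW (l_prime_le pp op).
Qed.

Lemma admissibleU1 A p : p \notin A -> admissible (p |: A) ->
  admissible A && (prime p && odd p).
Proof.
move=> pA adm; have pp := admissibleP adm (finset.setU11 p A).
rewrite pp andbT; apply/andP; split.
  apply/forall_inP => q qA; apply: (admissibleP adm).
  by rewrite inE qA orbT.
apply: leq_ltn_trans (proj2 (andP adm)).
by rewrite big_setU1//= leq_pmull// prime_gt0//; case/andP: pp.
Qed.

Lemma weightU1_le eps alpha A p : p \notin A ->
  weight eps alpha (p |: A) <= if admissible A && (prime p && odd p) then
    (l p %/ gcdn (l p) (lcm_l A))%:R `^ (- alpha) * p%:R `^ (-1 + eps) *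
    weight eps alpha A else 0.
Proof.
move=> pA; rewrite {1}/weight; case: ifP => [adm|_]; last first.
  by case: ifP => // _; rewrite !mulr_ge0 ?powR_ge0 ?weight_ge0.
have h := admissibleU1 pA adm; rewrite h; case/andP: h => admA _.
rewrite /weight admA big_setU1//= /lcm_l big_setU1//= -/(lcm_l A).
(* The new least common multiple is the old one times [l p / gcd]. *)
rewrite /lcmn -divn_mulAC ?dvdn_gcdl// !natrM !powRM//.
by rewrite le_eqVlt; apply/orP; left; apply/eqP; ring.
Qed.

(** [M] bounds the total factor gained by adjoining one prime to any admissible set, so
    [sum_set_le_expR] applies; the empty set has weight at most 1. *)
Lemma sum_weight_le eps kappa M : 0 <= eps <= 1 -> 0 < kappa -> 0 <= M ->
  (forall t, (0 < t < N)%N ->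
     (2 + kappa^-1) * (1 + kappa^-1) * divisor_sum t (2 * eps + kappa) <= M) ->
  \sum_A weight eps (2 * eps + 2 * kappa) A <= expR M.
Proof.
move=> e01 k0 M0 HM; set alpha := 2 * eps + 2 * kappa.
apply: (@le_trans _ _ (weight eps alpha finset.set0 * expR M)); last first.
  rewrite ler_piMl ?expR_ge0// /weight; case: ifP => // _.
  by rewrite /lcm_l !big_set0 !powR1 mulr1.
apply: sum_set_le_expR => // [A|A]; first exact: weight_ge0.
apply: le_trans (ler_sum _ (fun p pA => weightU1_le eps alpha pA)) _.
rewrite -big_mkcondr /=.
case: (boolP (admissible A)) => [adm|_]; last first.
  by rewrite big_pred0 ?mulr_ge0 ?weight_ge0// => p; rewrite andbF.
rewrite -mulr_suml ler_wpM2r ?weight_ge0//.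
have t0 : (0 < lcm_l A < N)%N by rewrite lcm_l_gt0 ?lcm_l_lt.
apply: le_trans (HM _ t0).
apply: le_trans (sum_prime_le N (proj1 (andP t0)) e01 k0).
apply: ler_sum_subpred => p; first by case/andP.
by rewrite mulr_ge0 ?powR_ge0.
Qed.

(** * Squarefree part and square part, and Rankin's trick *)

Definition odd_part (n : nat) : {set 'I_N} := [set p : 'I_N | odd (logn p n)].
(** This is [b] in [n = a * b^2]. Since [logn p n = 0] for nonprime [p], only primes contribute. *)
Definition root_part (n : nat) : nat := (\prod_(p < N) p ^ (logn p n)./2)%N.

Lemma odd_root_part (n : nat) : (0 < n < N)%N ->
  n = ((\prod_(p in odd_part n) p) * root_part n ^ 2)%N.
Proof.
case/andP=> n0 nN.
have nN1 : (n <= N.-1)%N by lia.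
rewrite -{1}(partnT n0) (widen_partn _ nN1) prednK; last by lia.
rewrite big_mkord expnS expn1 /root_part [X in (X * _)%N]big_mkcond /=.
rewrite -!big_split /=; apply: eq_bigr => p _; rewrite inE.
rewrite -{1}(odd_double_half (logn p n)) -addnn !expnD.
by case: odd; rewrite ?expn1.
Qed.

Lemma root_part_gt0 (n : nat) : (0 < n < N)%N -> (0 < root_part n)%N.
Proof.
move=> nN; have := odd_root_part nN; case: posnP => // ->.
by rewrite muln0 => n0; move: nN; rewrite n0.
Qed.

Lemma root_part_lt (n : nat) : (0 < n < N)%N -> (root_part n < N)%N.
Proof.
move=> nN; have b0 := root_part_gt0 nN; have nE := odd_root_part nN.
case/andP: nN => n0; apply: leq_ltn_trans.
rewrite [leqRHS]nE; have : (0 < \prod_(p in odd_part n) p)%N.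
  by move: n0; rewrite {1}nE muln_gt0 => /andP[].
move=> P0; apply: leq_trans (leq_pmull _ P0).
by rewrite -{1}(expn1 (root_part n)) leq_pexp2l.
Qed.

Lemma admissible_odd_part (n : nat) : odd n -> (n < N)%N ->
  admissible (odd_part n).
Proof.
move=> on nN; have n0 := odd_gt0 on.
have nN' : (0 < n < N)%N by rewrite n0.
apply/andP; split.
  apply/forall_inP => p; rewrite inE => /odd_gt0; rewrite logn_gt0 mem_primes.
  by case/and3P=> -> _ /dvdn_odd; apply.
apply: leq_ltn_trans nN; rewrite [leqRHS](odd_root_part nN') leq_pmulr//.
by rewrite expn_gt0 root_part_gt0.
Qed.

Lemma lcm_l_odd_part_le (n : nat) : odd n -> (lcm_l (odd_part n) <= l n)%N.
Proof.
move=> on; apply: dvdn_leq; first exact: l_gt0.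
apply/dvdn_biglcmP => p; rewrite inE => /odd_gt0; rewrite logn_gt0 mem_primes.
by case/and3P=> _ _; exact: l_dvd_l.
Qed.

Lemma powR_small_order_le (n : nat) eps alpha : odd n -> (n < N)%N ->
  0 <= eps <= 1 / 4 -> 0 <= alpha ->
  n%:R `^ (-1 + eps) * (l n)%:R `^ (- alpha) <=
    weight eps alpha (odd_part n) * (root_part n)%:R `^ (-1 - 1 / 2).
Proof.
move=> on nN /andP[e0 e4] a0; have n0 := odd_gt0 on.
have nN' : (0 < n < N)%N by rewrite n0.
have adm := admissible_odd_part on nN.
have b1 := root_part_gt0 nN'.
rewrite {1}(odd_root_part nN') /weight adm natrM powRM// -mulrA.
rewrite -[leRHS]mulrA ler_wpM2l ?powR_ge0// mulrC; apply: ler_pM; rewrite ?powR_ge0//.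
  apply: ler_powR_nonpos; rewrite ?ltr0n ?lcm_l_gt0 ?ler_nat ?oppr_le0//.
  exact: lcm_l_odd_part_le.
(* [eps <= 1 / 4] gives [b^(-2 + 2 * eps) <= b^(-3/2)], summable uniformly in [eps]. *)
rewrite natrX -powR_mulrn// -powRrM; apply: ler_powR; last by lra.
by rewrite ler1n.
Qed.

Lemma card_small_order_le (x y : R) eps kappa M :
  0 <= eps <= 1 / 4 -> 0 < kappa -> 0 <= M ->
  (forall n : nat, (n < N)%N -> n%:R <= x) -> 0 <= x -> 0 <= y ->
  (forall t, (0 < t < N)%N ->
     (2 + kappa^-1) * (1 + kappa^-1) * divisor_sum t (2 * eps + kappa) <= M) ->
  #|[set n : 'I_N | odd n & (l n)%:R <= y]|%:R <=
    x `^ (1 - eps) * y `^ (2 * eps + 2 * kappa) * (3 * expR M).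
Proof.
move=> /andP[e0 e4] k0 M0 xN x0 y0 HM; set alpha := 2 * eps + 2 * kappa.
have a0 : 0 <= alpha by rewrite /alpha; lra.
have e01 : 0 <= eps <= 1 by apply/andP; split; lra.
(* Rankin's trick: [n <= x] and [l n <= y] make both [(x / n)^(1 - eps)] and [(y / l n)^alpha] at
   least 1. *)
have term n : odd n && ((l n)%:R <= y) ->
    1 <= x `^ (1 - eps) * y `^ alpha *
      (weight eps alpha (odd_part n) * (root_part n)%:R `^ (-1 - 1 / 2)).
  case/andP=> on ly.
  have n0 : 0 < n%:R :> R by rewrite ltr0n odd_gt0.
  have l0 : 0 < (l n)%:R :> R by rewrite ltr0n l_gt0.
  have xn : 1 <= x `^ (1 - eps) * n%:R `^ (-1 + eps).
    rewrite (_ : -1 + eps = - (1 - eps)); last by ring.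
    rewrite powRN ler_pdivlMr ?powR_gt0// mul1r.
    by apply: ge0_ler_powR; rewrite ?nnegrE ?xN//; lra.
  have yl : 1 <= y `^ alpha * (l n)%:R `^ (- alpha).
    rewrite powRN ler_pdivlMr ?powR_gt0// mul1r.
    by apply: ge0_ler_powR; rewrite ?nnegrE.
  apply: le_trans (ler_wpM2l _ (powR_small_order_le on (ltn_ord n) _ a0)).
  - by rewrite mulrACA; rewrite -[leLHS]mulr1; apply: ler_pM.
  - by rewrite mulr_ge0 ?powR_ge0.
  - by rewrite e0.
have bN n : odd n && ((l n)%:R <= y) -> (root_part n < N)%N.
  by case/andP=> on _; apply: root_part_lt; rewrite odd_gt0/=.
case: (posnP N) => [N0|N0].
  rewrite (_ : #|_| = 0%N) ?mulr_ge0 ?powR_ge0 ?expR_ge0//.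
  by apply: eq_card0 => n; case: n => m; rewrite N0.
rewrite -[leLHS]mulr1 cardsE.
rewrite -(sumr_const_cond (fun n : 'I_N => odd n && ((l n)%:R <= y))).
apply: le_trans (ler_sum _ term) _; rewrite -mulr_sumr.
rewrite ler_wpM2l ?mulr_ge0 ?powR_ge0//.
pose h n : {set 'I_N} * 'I_N := (odd_part n, insubd (Ordinal N0) (root_part n)).
pose G (q : {set 'I_N} * 'I_N) : R := weight eps alpha q.1 * q.2%:R `^ (-1 - 1 / 2).
rewrite (eq_bigr (fun n => G (h n))); last first.
  by move=> n Pn; rewrite /G /h /= insubdK// unfold_in bN.
(* Since [n] is recovered from its two parts, enlarging to all pairs makes the sum a product. *)
apply: (@le_trans _ _
    (\sum_(q : {set 'I_N} * 'I_N | predT q.1 && (0 < q.2)%N) G q)).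
  apply: (@ler_sum_inj R _ _ _ _ h G).
  - move=> n m Pn Pm /(congr1 (fun q => (q.1, val q.2))).
    rewrite /h /= !insubdK ?unfold_in ?bN// => -[e1 e2]; apply: val_inj => /=.
    have n0 : (0 < n < N)%N by case/andP: Pn => /odd_gt0 ->/=.
    have m0 : (0 < m < N)%N by case/andP: Pm => /odd_gt0 ->/=.
    by rewrite (odd_root_part n0) (odd_root_part m0) e1 e2.
  - move=> n Pn; rewrite /h /= insubdK ?unfold_in ?bN//.
    by apply: root_part_gt0; case/andP: Pn => /odd_gt0 ->/=.
  - by move=> q _; rewrite /G mulr_ge0 ?weight_ge0 ?powR_ge0.
rewrite -(pair_big_dep predT (fun _ (b : 'I_N) => (0 < b)%N)
   (fun A (b : 'I_N) => weight eps alpha A * b%:R `^ (-1 - 1 / 2))) /=.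
under eq_bigr do rewrite -mulr_sumr.
rewrite -mulr_suml mulrC; apply: ler_pM.
- by rewrite sumr_ge0// => b _; rewrite powR_ge0.
- by rewrite sumr_ge0// => A _; rewrite weight_ge0.
- rewrite (_ : 3 = 1 + (1 / 2)^-1); last by field.
  apply: (@sum_inj_powRN_le _ _ _ (fun b : 'I_N => b : nat)) => //.
  by move=> b c _ _; exact: val_inj.
- exact: sum_weight_le.
Qed.

End Rankin.

(** * Choice of parameters *)

Section Asymptotics.
Variable R : realType.
Implicit Types d w x : R.

Lemma expR_half_le2 : expR (1 / 2) <= 2 :> R.
Proof.
have := expR_ge1Dx (- (1 / 2) : R); rewrite expRN => h.
have e0 := expR_gt0 (1 / 2 : R).
by have := ler_wpM2l (ltW e0) h; rewrite mulfV ?gt_eqF//; lra.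
Qed.

Lemma expR1_le4 : expR 1 <= 4 :> R.
Proof.
have -> : 1 = 1 / 2 + 1 / 2 :> R by field.
rewrite expRD; have := expR_half_le2; have := expR_gt0 (1 / 2 : R); nra.
Qed.

Lemma exists_dyadic (u : R) : 1 <= u ->
  exists K : nat, (2 ^ K)%:R <= u < (2 ^ K.+1)%:R.
Proof.
move=> u1; have u0 : 0 <= u by lra.
have n0 : (0 < Num.truncn u)%N by rewrite truncn_gt0.
exists (trunc_log 2 (Num.truncn u)).
by rewrite -truncn_ge_nat// -truncn_lt_nat//; exact: trunc_log_bounds.
Qed.

(** Here and below [w] stands for [ln (ln x)]. *)
Lemma log_log_bounds d w : 0 < d <= 1 / 4 -> (20 / d) ^+ 3 <= w ->
  [/\ 16 <= w, 11 * w ^+ 3 / d ^+ 3 <= expR (w / 2), 1 <= ln w & ln w <= w / 2].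
Proof.
move=> /andP[d0 d4]; set r := 20 / d => rw.
have r16 : 16 <= r by rewrite /r ler_pdivlMr//; lra.
have r2 : 1 <= r ^+ 2 by rewrite expr_ge1//; lra.
have w16 : 16 <= w.
  by apply: le_trans rw; rewrite exprS; nra.
have w0 : 0 < w by lra.
(* The quartic Taylor term is [w^4 / 384], and [w >= 8000 / d^3] makes it exceed
   [20 * w^3 / d^3]. *)
have h : 11 * w ^+ 3 / d ^+ 3 <= expR (w / 2).
  apply: le_trans (_ : 1 + (w / 2) ^+ 4 / 4`!%:R <= _); last first.
    by apply: expR_ge1Dxn; lra.
  have -> : (4`!%:R : R) = 24 by [].
  have dE : d^-1 = r / 20 by rewrite /r; field; rewrite gt_eqF.
  rewrite -exprVn dE.
  have w3 : 0 <= w ^+ 3 by rewrite exprn_ge0// ltW.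
  have w4 : 0 <= w ^+ 4 by rewrite exprn_ge0// ltW.
  have := ler_wpM2l w3 rw; rewrite -exprSr; lra.
split => //.
  rewrite -(expRK 1) ler_ln ?posrE ?expR_gt0//; have := expR1_le4; lra.
rewrite -[w / 2]expRK ler_ln ?posrE ?expR_gt0//; apply: le_trans h.
have w2 : 1 <= w ^+ 2 by rewrite expr_ge1//; lra.
rewrite ler_pdivlMr ?exprn_gt0//.
have : d ^+ 3 <= 1 by rewrite exprn_ile1//; lra.
have -> : w ^+ 3 = w * w ^+ 2 by rewrite exprS.
nra.
Qed.

(** The factor 16 is 4 from the Euler factors times 4 from [y_le]; the rest comes from [kc]. *)
Definition log_log_const d : R := 16 * (1 + 6 * (1 + (d / 2)^-1)).

Lemma divisor_sum_log_log_le d w t : 0 < d <= 1 / 4 -> 16 <= w ->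
  0 <= ln w <= w / 2 ->
  2 * log_log_const d <= w `^ (d / 2) ->
  (0 < t)%N -> t%:R <= expR (expR w) :> R ->
  divisor_sum t ((1 - d) * (ln w / w)) <= expR (w / 2).
Proof.
move=> /andP[d0 d4] w16 /andP[lw0 lww] wC t0 tle.
have w0 : 0 < w by lra.
set s := (1 - d) * (ln w / w).
have lam0 : 0 <= ln w / w by rewrite divr_ge0// ltW.
have lam2 : ln w / w <= 1 / 2 by rewrite ler_pdivrMr//; lra.
have s0 : 0 <= s by rewrite mulr_ge0//; lra.
have s2 : s <= 1 / 2 by rewrite /s; nra.
have [K /andP[Kle Klt]] : exists K : nat, (2 ^ K)%:R <= expR w < (2 ^ K.+1)%:R.
  by apply: exists_dyadic; have := expR_ge1Dx w; lra.
have K2w : K%:R <= 2 * w.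
  have : expR (K%:R * (1 / 2)) <= expR w.
    apply: le_trans Kle; rewrite expRM_natl natrX lerXn2r ?nnegrE ?expR_ge0//.
    exact: expR_half_le2.
  by rewrite ler_expR; lra.
(* From [e <= 4]: [exp(2 ^ K.+1) <= 4 ^ (2 ^ K.+1) = 2 ^ (2 ^ K.+2)]. *)
have tK : (0 < t < 2 ^ (2 ^ K.+2))%N.
  rewrite t0 /= -(ltr_nat R); apply: le_lt_trans tle _.
  apply: (@lt_le_trans _ _ (expR (2 ^ K.+1)%:R)); first by rewrite ltr_expR.
  rewrite -[X in expR X]mulr1 expRM_natl (expnS 2 K.+1) expnM natrX.
  by rewrite lerXn2r ?nnegrE ?expR_ge0 ?expR1_le4.
have d20 : 0 < d / 2 by lra.
apply: le_trans (divisor_sum_le_expR (N := t.+1) _ s2) _; first by rewrite t0 /=.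
rewrite ler_expR.
have s01 : 0 <= s <= 1 by apply/andP; split; lra.
apply: le_trans (ler_wpM2l _ (sum_prime_dvd_le t.+1 tK s01 d20)) _ => //.
have y_le : (2 ^ K.+2)%:R `^ s <= 4 * w `^ (1 - d).
  apply: (@le_trans _ _ ((4 * expR w) `^ s)).
    apply: ge0_ler_powR => //; rewrite ?nnegrE ?mulr_ge0 ?expR_ge0//.
    by rewrite !expnS mulnA natrM ler_wpM2l.
  rewrite powRM ?expR_ge0//; apply: ler_pM; rewrite ?powR_ge0//.
    by apply: ler1_powR; lra.
  rewrite -expRM /powR gt_eqF// ler_expR /s.
  by rewrite le_eqVlt; apply/orP; left; apply/eqP; field; rewrite gt_eqF.
have K_le : K.+1%:R `^ (d / 2) <= 3 * w `^ (d / 2).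
  apply: (@le_trans _ _ ((3 * w) `^ (d / 2))).
    apply: ge0_ler_powR; rewrite ?nnegrE; [lra|by []|lra|].
    by rewrite -natr1; lra.
  rewrite powRM ?(ltW w0)// ler_wpM2r ?powR_ge0//; apply: ler1_powR; lra.
set a := w `^ (d / 2) in wC K_le *; set y := _ `^ s in y_le *.
set b := w `^ (1 - d) in y_le *.
set k := _ `^ (d / 2) in K_le *; set c := 1 + (d / 2)^-1.
have C0 : 0 < log_log_const d.
  by rewrite /log_log_const mulr_gt0// addr_gt0// mulr_gt0// addr_gt0// invr_gt0.
have a1 : 1 <= a.
  apply: le_trans wC; rewrite /log_log_const.
  have : 0 < (d / 2)^-1 by rewrite invr_gt0.
  lra.
have c0 : 0 <= c by rewrite /c addr_ge0// invr_ge0 ltW.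
have b0 : 0 <= b by exact: powR_ge0.
have y0 : 0 <= y by exact: powR_ge0.
have k0 : 0 <= k by exact: powR_ge0.
(* The second factor [a = w^(d / 2)] is what absorbs [2 * log_log_const d]. *)
have baa : b * a * a = w.
  by rewrite /b /a -!powRD_gt0// -[RHS]powRr1 ?(ltW w0)//; congr (_ `^ _); field.
have kc : 1 + 2 * (k * c) <= a * (1 + 6 * c).
  have := ler_wpM2r c0 K_le; have := ler_wpM2r c0 a1; lra.
apply: (@le_trans _ _ (4 * ((4 * b) * (a * (1 + 6 * c))))).
  rewrite ler_wpM2l//; apply: ler_pM => //.
  by rewrite addr_ge0// mulr_ge0// mulr_ge0.
have -> : 4 * (4 * b * (a * (1 + 6 * c))) = b * a * log_log_const d.
  by rewrite /log_log_const -/c; ring.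
have ba0 : 0 <= b * a by rewrite mulr_ge0//; lra.
have := ler_wpM2l ba0 wC; rewrite baa; lra.
Qed.

Lemma powR_le_self (c d w : R) : 0 < d -> 0 <= c -> c `^ (2 / d) <= w ->
  c <= w `^ (d / 2).
Proof.
move=> d0 c0 cw.
have -> : c = (c `^ (2 / d)) `^ (d / 2).
  rewrite -powRrM (_ : 2 / d * (d / 2) = 1) ?powRr1//.
  by field; rewrite gt_eqF.
apply: ge0_ler_powR; rewrite ?nnegrE ?powR_ge0//; first by rewrite divr_ge0// ltW.
exact: le_trans (powR_ge0 _ _) cw.
Qed.

(** The left side is [M] plus 2, the 2 covering the constant 3 by [3 <= exp 2]. It has order
    [w^2 * sqrt (ln x)], against [d * ln (calL x)] on the right. *)
Lemma small_order_error_le d w : 0 < d <= 1 / 4 -> 16 <= w ->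
  11 * w ^+ 3 / d ^+ 3 <= expR (w / 2) -> 1 <= ln w ->
  2 + 9 * w ^+ 2 / d ^+ 2 * expR (w / 2) <= d * (expR w * (ln w / w)).
Proof.
move=> /andP[d0 d4] w16 ew lw1; have w0 : 0 < w by lra.
have e0 := expR_gt0 (w / 2).
have -> : expR w = expR (w / 2) * expR (w / 2) by rewrite -expRD; congr expR; field.
set e := expR (w / 2) in ew e0 *.
have e1 : 1 <= e by have := expR_ge1Dx (w / 2); rewrite -/e; lra.
apply: (@le_trans _ _ (d * (e * e * w^-1))); last first.
  rewrite ler_pM2l// ler_wpM2l ?mulr_ge0 ?(ltW e0)// -[leLHS]mul1r ler_wpM2r//.
  by rewrite invr_ge0 ltW.
apply: (@le_trans _ _ (11 * w ^+ 2 / d ^+ 2 * e)); last first.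
  have -> : 11 * w ^+ 2 / d ^+ 2 * e = d * (e * (11 * w ^+ 3 / d ^+ 3) * w^-1).
    by field; rewrite !gt_eqF.
  rewrite ler_pM2l// ler_wpM2r ?invr_ge0 ?(ltW w0)// ler_wpM2l// ltW//.
have : 1 <= w ^+ 2 / d ^+ 2.
  rewrite ler_pdivlMr ?exprn_gt0// mul1r lerXn2r ?nnegrE//; lra.
set q := w ^+ 2 / d ^+ 2 => q1.
rewrite -!(mulrA _ (w ^+ 2)) -/q; nra.
Qed.

Lemma weight_factor_le d w : 0 < d <= 1 / 4 -> 16 <= w -> 1 <= ln w ->
  (2 + (d * (ln w / w))^-1) * (1 + (d * (ln w / w))^-1)
    <= 9 * w ^+ 2 / d ^+ 2.
Proof.
move=> /andP[d0 d4] w16 lw1; have w0 : 0 < w by lra.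
have -> : 9 * w ^+ 2 / d ^+ 2 = (3 * (w / d)) * (3 * (w / d)).
  by field; rewrite gt_eqF.
have wd1 : 1 <= w / d by rewrite ler_pdivlMr//; lra.
have kw : (d * (ln w / w))^-1 <= w / d.
  have -> : (d * (ln w / w))^-1 = w / d * (ln w)^-1.
    by field; rewrite !gt_eqF//; lra.
  by rewrite ler_piMr ?invf_le1//; lra.
have k0 : 0 <= (d * (ln w / w))^-1.
  by rewrite invr_ge0 mulr_ge0 ?divr_ge0//; lra.
apply: ler_pM; lra.
Qed.

End Asymptotics.

Theorem corollary1p2 (R : realType) (delta : R) (hdelta : 0 < delta) :
  exists x0 : R, forall x : R, x0 <= x -> forall beta : R, 0 <= beta ->
    (count_small_order x (x `^ beta))%:R
      <= x / (calL x) `^ (1 / 2 - beta - delta).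
Proof.
(* The loss [d] occurs twice, in [eps] and in the error term, so [2 * d <= delta] is required. *)
pose d := Num.min (delta / 2) (1 / 4).
have d0 : 0 < d by rewrite lt_min; apply/andP; split; lra.
have d4 : d <= 1 / 4 by rewrite ge_min lexx orbT.
have dd : d <= delta / 2 by rewrite ge_min lexx.
have d04 : 0 < d <= 1 / 4 by rewrite d0.
(* The first summand ensures [wC], the second the hypothesis of [log_log_bounds]. *)
pose w0 : R := (2 * log_log_const d) `^ (2 / d) + (20 / d) ^+ 3.
exists (expR (expR w0)) => x x0x beta beta0.
have x0 : 0 < x := lt_le_trans (expR_gt0 _) x0x.
have u0 : expR w0 <= ln x by rewrite -[leLHS]expRK ler_ln ?posrE ?expR_gt0.
have u0' : 0 < ln x := lt_le_trans (expR_gt0 _) u0.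
pose w := ln (ln x).
have w0w : w0 <= w by rewrite -[leLHS]expRK ler_ln ?posrE ?expR_gt0.
have uE : ln x = expR w by rewrite lnK.
have xE : x = expR (expR w) by rewrite -uE lnK.
have p0 := powR_ge0 (2 * log_log_const d) (2 / d).
have q0 : 0 <= (20 / d) ^+ 3 by rewrite exprn_ge0// divr_ge0// ltW.
have wd : (20 / d) ^+ 3 <= w by apply: le_trans w0w; rewrite /w0; lra.
have [w16 ew lw1 lw2] := log_log_bounds d04 wd.
have wC : 2 * log_log_const d <= w `^ (d / 2).
  apply: powR_le_self => //; last by apply: le_trans w0w; rewrite /w0; lra.
  have : 0 < (d / 2)^-1 by rewrite invr_gt0; lra.
  by rewrite /log_log_const; lra.
have wpos : 0 < w by lra.
pose lam := ln w / w.
have lam0 : 0 < lam by rewrite divr_gt0//; lra.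
have lam2 : lam <= 1 / 2 by rewrite ler_pdivrMr//; lra.
pose eps := (1 / 2 - d) * lam; pose kappa := d * lam.
have eps01 : 0 <= eps <= 1 / 4.
  by apply/andP; split; rewrite /eps; nra.
have kappa0 : 0 < kappa by rewrite mulr_gt0.
pose M := 9 * w ^+ 2 / d ^+ 2 * expR (w / 2).
have M0 : 0 <= M.
  by rewrite mulr_ge0 ?expR_ge0// divr_ge0 ?mulr_ge0 ?exprn_ge0 ?(ltW d0) ?(ltW wpos).
have xN (n : nat) : (n < (Num.truncn x).+1)%N -> n%:R <= x.
  by rewrite ltnS truncn_ge_nat// ltW.
have alphaE : 2 * eps + 2 * kappa = lam by rewrite /eps /kappa; field.
have HM t : (0 < t < (Num.truncn x).+1)%N ->
    (2 + kappa^-1) * (1 + kappa^-1) * divisor_sum t (2 * eps + kappa) <= M.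
  case/andP=> t0 tN.
  have -> : 2 * eps + kappa = (1 - d) * (ln w / w).
    by rewrite /eps /kappa -/lam; field.
  apply: ler_pM.
  - by rewrite mulr_ge0// addr_ge0// invr_ge0 ltW.
  - by rewrite sumr_ge0// => g _; exact: powR_ge0.
  - exact: weight_factor_le.
  - apply: divisor_sum_log_log_le => //; last by rewrite -xE xN.
    by apply/andP; split; lra.
rewrite /count_small_order.
apply: le_trans (card_small_order_le eps01 kappa0 M0 xN (ltW x0)
  (powR_ge0 _ _) HM) _.
(* [(x^beta)^lam] is exactly [calL x] to the power [beta], so the threshold does not depend on
   [beta]. *)
rewrite alphaE -powRrM -powRD_gt0//.
have -> : calL x = expR (expR w * lam).
  by rewrite /calL /logk /= -/w uE /lam mulrA.
have h3 : (3 : R) <= expR 2 by apply: le_trans (expR_ge1Dx _); lra.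
apply: (@le_trans _ _ (x `^ (1 - eps + beta * lam) * expR (2 + M))).
  by rewrite ler_wpM2l ?powR_ge0// expRD ler_wpM2r// expR_ge0.
rewrite -expRM -expRN {1}/powR gt_eqF// uE xE -!expRD ler_expR.
have err := small_order_error_le d04 w16 ew lw1.
have ul0 : 0 <= expR w * lam by rewrite mulr_ge0 ?expR_ge0// ltW.
have := ler_wpM2r ul0 dd.
rewrite -/M -/lam in err; rewrite /eps.
set u := expR w in err *; set ul := u * lam in err *.
have -> : (1 - (1 / 2 - d) * lam + beta * lam) * u = u - (1 / 2 - d) * ul + beta * ul.
  by rewrite /ul; ring.
lra.
Qed.
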